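(* For every $\epsilon > 0$ there is a constant $C = C(\epsilon) > 0$, depending only on $\epsilon$, such that for every prime $p$ and every real number $X$ with $1 \le X \le \frac{p}{12}$, $$ S(X) \le C \min\left( X^{\epsilon} + \frac{X^{2+\epsilon}}{p},\ p^{1/2} \right). $$ Here $S(X)$ (which depends on $p$) is the maximum of the cardinalities $|A|$ over all subsets $A \subseteq \mathbb{F}_p^*$ such that for each $(s_1,s_2) \in A^2$ at least one of $\left|\frac{s_1}{s_2}\right|_p \le X$ and $\left|\frac{s_2}{s_1}\right|_p \le X$ holds.
   Context: Let $p$ be a prime, $\mathbb{F}_p = \mathbb{Z}/p\mathbb{Z}$ and $\mathbb{F}_p^* = \mathbb{F}_p \setminus \{0\}$. For an integer $\alpha$ representing a class of $\mathbb{Z}/p\mathbb{Z}$, write $|\alpha|_p := \min_{k \in \mathbb{Z}} |\alpha + kp|$; this depends only on the class of $\alpha$ modulo $p$, so $|x|_p$ is defined for $x \in \mathbb{F}_p$. The ratios $s_1/s_2$ are taken in the field $\mathbb{F}_p$. For a finite set $A$, $|A|$ denotes its cardinality. *)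

(* Defs.v *)
From HB Require Import structures.
From mathcomp Require Import all_boot all_order all_algebra.
From mathcomp Require Import all_classical all_reals all_analysis.

Set Implicit Arguments.
Unset Strict Implicit.
Unset Printing Implicit Defensive.

Import Order.TTheory GRing.Theory Num.Theory.

Local Open Scope ring_scope.

Lemma absmod_subproof (p : nat) (a : int) :
  exists n : nat, `[< exists k : int, n = `|(a + k * p%:Z)%R|%N >].
Proof. by exists `|(a + 0 * p%:Z)%R|%N; apply/asboolP; exists 0. Qed.

(* |a|_p, the minimum of |a + k p| over all integers k *)
Definition absmod (p : nat) (a : int) : nat := ex_minn (absmod_subproof p a).

(* |x|_p for a class x, computed on its representative in [0, p);
   by absFpE any other representative gives the same value *)
Definition absFp (p : nat) (x : 'F_p) : nat := absmod p (nat_of_ord x)%:Z.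

Lemma absmodDM (p : nat) (a m : int) : absmod p (a + m * p%:Z) = absmod p a.
Proof.
rewrite /absmod; case: ex_minnP => n /asboolP[k nE] nmin.
case: ex_minnP => n' /asboolP[k' nE'] nmin'.
apply/eqP; rewrite eqn_leq; apply/andP; split.
  apply: nmin; apply/asboolP; exists (k' - m).
  by rewrite nE' -addrA -mulrDl (addrC m) subrK.
by apply: nmin'; apply/asboolP; exists (m + k); rewrite nE mulrDl addrA.
Qed.

Lemma absFpE (p : nat) (x : 'F_p) (a : int) :
  prime p -> a%:~R = x -> absFp x = absmod p a.
Proof.
move=> p_pr ax.
have p0 : p%:Z != 0 by rewrite eqz_nat -lt0n prime_gt0.
have [r rE] : exists r : nat, (a %% p%:Z)%Z = r%:Z.
  by exists `|(a %% p%:Z)%Z|%N; rewrite gez0_abs // modz_ge0.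
have rp : (r < p)%N by rewrite -ltz_nat -rE ltz_pmod // ltz_nat prime_gt0.
have aE : a = r%:Z + (a %/ p%:Z)%Z * p%:Z by rewrite -rE addrC -divz_eq.
have xr : x = r :> nat.
  have pF0 : (p%:Z)%:~R = 0 :> 'F_p by rewrite -pmulrn pchar_Fp_0.
  rewrite -ax aE intrD intrM pF0 mulr0 addr0 -pmulrn.
  by rewrite val_Fp_nat // modn_small.
by rewrite [in RHS]aE absmodDM /absFp xr.
Qed.

Section RatioBounded.
Variables (R : realType) (p : nat) (X : R).

Definition ratio_bounded (A : {set 'F_p}) : bool :=
  [forall s1 in A, forall s2 in A,
     ((absFp (s1 / s2))%:R <= X) || ((absFp (s2 / s1))%:R <= X)].

(* S(X); meaningful for p prime, when 'F_p is Z/pZ *)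
Definition maxcard : nat :=
  \max_(A : {set 'F_p} | (A \subset [set~ 0]) && ratio_bounded A) #|A|.

End RatioBounded.

(* Main.v *)
(* Let A be admissible and x the integer part of X.

   Bound by sqrt p: lift the ratios of absolute value at most x to differences
   j - i with 0 <= j < x.  A pair (a, b) with b = (j - i) a is an incidence
   between the point (i, b) and the line of slope -a and intercept a j.  The
   second moment of the number of points on a line bounds the error in the
   incidence count, while at least half of the pairs in A^2 contribute.

   Bound by X^eps + X^(2+eps)/p: some s in A has |b/s| <= x for at least half of
   the b in A, and among these b some a has |a/b| <= x for at least half.
   Writing a/s = alpha, b/s = beta and a/b = r with integers of absolute value
   at most x, beta divides alpha - k p = r beta for some |k| <= (x^2 + x)/p,
   and the divisor bound limits the number of beta for each k. *)

Require Import Defs.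
From mathcomp Require Import all_boot all_order all_algebra.
From mathcomp Require Import all_classical all_reals all_analysis.
From mathcomp Require Import zify ring lra.
Import Order.TTheory GRing.Theory Num.Theory.

Set Implicit Arguments.
Unset Strict Implicit.

(** * The divisor bound *)

(** Raise e + 1 <= k (floor(e/k) + 1) <= k 2^floor(e/k) to the power k. This controls the
    contribution of a small prime of exponent e to the k-th power of the divisor count. *)
Lemma leq_succ_mul_expn2 (k e : nat) : (0 < k)%N ->
  (e.+1 ^ k <= k ^ k * 2 ^ e)%N.
Proof.
move=> k0; have e1 : (e.+1 <= k * 2 ^ (e %/ k))%N.
  apply: (@leq_trans (k * (e %/ k).+1)); last
    by rewrite leq_mul2l ltn_expl ?orbT.
  by rewrite mulnC ltn_ceil.
apply: (@leq_trans ((k * 2 ^ (e %/ k)) ^ k)); first by rewrite leq_exp2r.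
by rewrite expnMn -expnM leq_mul2l leq_exp2l // leq_divM orbT.
Qed.

Lemma size_divisors_partn (p n : nat) : prime p -> (0 < n)%N ->
  (size (divisors n) <= (logn p n).+1 * size (divisors n`_p^'))%N.
Proof.
move=> p_pr n0.
pose s := [seq p ^ i * d | i <- iota 0 (logn p n).+1, d <- divisors n`_p^'].
have <- : size s = ((logn p n).+1 * size (divisors n`_p^'))%N.
  by rewrite size_allpairs size_iota.
apply: uniq_leq_size (divisors_uniq n) _ => d; rewrite -dvdn_divisors // => dn.
have d0 := dvdn_gt0 n0 dn.
apply/allpairsP; exists (logn p d, d`_p^'); split.
- by rewrite mem_iota ltnS dvdn_leq_log.
- by rewrite -dvdn_divisors ?part_gt0 ?partn_dvd.
- by rewrite -p_part partnC.
Qed.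

(** Induction on [B], stripping the prime [B], of exponent e say, from [n]. If B >= 2^k this costs
    nothing, since (e + 1)^k <= 2^(e k) <= B^e; a smaller prime costs a factor k^k, and
    [minn B (2 ^ k)] bounds the number of those. *)
Lemma size_divisors_expn_smooth (k B n : nat) : (0 < k)%N -> (0 < n)%N ->
    (forall q, prime q -> q %| n -> q < B)%N ->
  (size (divisors n) ^ k <= (k ^ k) ^ minn B (2 ^ k) * n)%N.
Proof.
move=> k0; have K0 : (0 < k ^ k)%N by rewrite expn_gt0 k0.
elim: B n => [|B IHB] n n0 nB.
  have /eqP -> : n == 1%N.
    rewrite eqn_leq n0 andbT leqNgt; apply/negP=> n1.
    by have := nB _ (pdiv_prime n1) (pdiv_dvd n).
  by rewrite exp1n min0n.
have [/andP[B_pr Bn]|nBn] := boolP (prime B && (B %| n)%N); last first.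
  apply: (leq_trans (IHB n n0 _)).
    move=> q q_pr qn; have := nB q q_pr qn.
    rewrite ltnS leq_eqVlt => /predU1P[qB|//].
    by rewrite -qB q_pr qn in nBn.
  by rewrite leq_mul2r leq_pexp2l ?orbT // leq_min !geq_min leqnSn leqnn ?orbT.
have e0 : (0 < logn B n)%N by rewrite logn_gt0 mem_primes B_pr n0.
apply: (leq_trans (n := ((logn B n).+1 * size (divisors n`_B^')) ^ k)).
  by rewrite leq_exp2r // size_divisors_partn.
have /IHB : (0 < n`_B^')%N by rewrite part_gt0.
have nB' q : prime q -> (q %| n`_B^')%N -> (q < B)%N.
  move=> q_pr qn; have := nB q q_pr (dvdn_trans qn (dvdn_part _ _)).
  rewrite ltnS leq_eqVlt => /predU1P[qB|//].
  by have := pnat_dvd qn (part_pnat _ _); rewrite pnatE // !inE qB eqxx.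
move=> /(_ nB') IH; rewrite expnMn -[X in (_ <= _ * X)%N](partnC B n0) p_part.
case: (ltnP B (2 ^ k)) => B2.
- rewrite (minn_idPl B2) (minn_idPl (ltnW B2)) in IH *.
  rewrite expnS mulnACA.
  apply: leq_mul IH; apply: (leq_trans (leq_succ_mul_expn2 _ k0)).
  by rewrite leq_mul2l leq_exp2r ?prime_gt1 ?orbT.
- rewrite (minn_idPr B2) (minn_idPr (leqW B2)) in IH *.
  rewrite mulnCA; apply: leq_mul IH.
  apply: (@leq_trans ((2 ^ logn B n) ^ k)); first
    by rewrite leq_exp2r // ltn_expl.
  by rewrite -expnM [X in (2 ^ X)%N]mulnC expnM leq_exp2r.
Qed.

Lemma size_divisors_expn (k n : nat) : (0 < k)%N -> (0 < n)%N ->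
  (size (divisors n) ^ k <= (k ^ k) ^ (2 ^ k) * n)%N.
Proof.
move=> k0 n0.
apply: (leq_trans (size_divisors_expn_smooth (B := n.+1) k0 n0 _)).
  by move=> q _ /dvdn_leq; rewrite ltnS; apply.
by rewrite leq_mul2r leq_pexp2l ?geq_minr ?orbT ?expn_gt0 ?k0.
Qed.

Local Open Scope ring_scope.

(** * Point-line incidences over a finite field *)

(** Cauchy-Schwarz: twice the defect is the double sum of (f i - f j)^2. *)
Lemma sum_sqr_le (R : realDomainType) (I : finType) (L : {set I}) (f : I -> R) :
  (\sum_(i in L) f i) ^+ 2 <= #|L|%:R * \sum_(i in L) f i ^+ 2.
Proof.
have : 0 <= \sum_(i in L) \sum_(j in L) (f i - f j) ^+ 2.
  by apply: sumr_ge0 => i _; apply: sumr_ge0 => j _; apply: sqr_ge0.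
have -> : \sum_(i in L) \sum_(j in L) (f i - f j) ^+ 2 =
    (#|L|%:R * (\sum_(i in L) f i ^+ 2) - (\sum_(i in L) f i) ^+ 2) *+ 2.
  rewrite (eq_bigr (fun i => f i ^+ 2 *+ #|L| + \sum_(j in L) f j ^+ 2
      - f i * (\sum_(j in L) f j) *+ 2)); last first.
    move=> i _; rewrite mulr_sumr -sumrMnl -sumr_const -big_split -sumrB /=.
    by apply: eq_bigr => j _; ring.
  rewrite sumrB big_split /= sumrMnl sumr_const sumrMnl -mulr_suml -mulr_natl.
  ring.
by rewrite pmulrn_lge0 // subr_ge0.
Qed.

Section Incidences.
Variable F : finFieldType.
Implicit Types P L : {set F * F}.

(** A line is the pair of its slope and intercept; vertical lines are left out, so each point lies
    on exactly [#|F|] lines. *)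
Definition on_line (u l : F * F) : bool := u.2 == l.1 * u.1 + l.2.

Definition line_card P (l : F * F) : nat := #|[set u in P | on_line u l]|.

(** A line through a given point is fixed by its slope, and two distinct points fix the slope. The
    slack of 1 when u = v gives a single formula that is easy to sum over all pairs. *)
Lemma card_lines_through (u v : F * F) :
  (#|[set l | on_line u l && on_line v l]| <= (u == v) * #|F| + 1)%N.
Proof.
have [<-|uv] := eqVneq.
  rewrite mul1n; apply: leq_trans (leq_addr _ _).
  rewrite -cardsT -(card_in_imset (f := fun l : F * F => l.1)).
    by apply: subset_leq_card; apply/fintype.subsetP.
  move=> l l'; rewrite !inE !andbb => /eqP e /eqP e' ll'.
  case: l l' ll' e e' => [m c] [m' c'] /= -> ->.
  by move/addrI=> ->.
rewrite mul0n add0n; apply/card_le1_eqP=> -[m c] [m' c'].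
rewrite !inE /on_line /= => /andP[/eqP e1 /eqP e2] /andP[/eqP e3 /eqP e4].
case: u v uv e1 e2 e3 e4 => [x y] [x' y'] /= uv e1 e2 e3 e4.
have xx' : x - x' != 0.
  apply: contraNneq uv => /eqP; rewrite subr_eq0 => /eqP xE.
  by rewrite xE xpair_eqE eqxx e1 e2 xE /=.
have mm' : m = m'.
  apply: (mulIf xx'); rewrite !mulrBr.
  have -> : m * x - m * x' = y - y' by rewrite e1 e2; ring.
  by rewrite e3 e4; ring.
by rewrite mm'; congr pair; move: e3; rewrite {1}e1 mm' => /addrI.
Qed.

Lemma card_lines_on (u : F * F) : #|[set l | on_line u l]| = #|F|.
Proof.
rewrite -cardsT -(card_imset (f := fun m : F => (m, u.2 - m * u.1))); last
  by move=> m m' [].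
apply: eq_card => -[m c]; rewrite inE /on_line /=.
apply/eqP/imsetP => [->|[m' _ [-> ->]]]; last by rewrite addrC subrK.
by exists m => //; rewrite addrAC subrr add0r.
Qed.

Lemma sum_line_card P : (\sum_l line_card P l = #|P| * #|F|)%N.
Proof.
rewrite -sum_nat_const; under [RHS]eq_bigr => u _ do rewrite -(card_lines_on u).
under eq_bigr => l _ do rewrite /line_card -sum1_card.
under [RHS]eq_bigr => u _ do rewrite -sum1_card.
by rewrite (exchange_big_dep (mem P)) => [|l u _]; rewrite /= ?inE;
  [apply: eq_bigr => u uP; apply: eq_bigl => l; rewrite !inE uP|case/andP].
Qed.

(** The second moment counts triples made of two points and a line through both. *)
Lemma sum_line_card_sqr P :
  (\sum_l line_card P l ^ 2 <= #|P| * #|F| + #|P| ^ 2)%N.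
Proof.
have lcE l : line_card P l = (\sum_(u in P) on_line u l)%N.
  rewrite /line_card -sum1_card big_mkcond [RHS]big_mkcond.
  apply: eq_bigr => u _; by rewrite inE; case: (u \in P); case: on_line.
have -> : (\sum_l line_card P l ^ 2 =
    \sum_(u in P) \sum_(v in P) #|[set l | on_line u l && on_line v l]|)%N.
  rewrite exchange_big /=.
  under [RHS]eq_bigr => v vP do under eq_bigr => u uP do
    rewrite -sum1_card big_mkcond /=.
  under [RHS]eq_bigr => v vP do rewrite exchange_big /=.
  rewrite exchange_big /=; apply: eq_bigr => l _.
  rewrite lcE -mulnn big_distrr /=; apply: eq_bigr => v vP.
  rewrite big_distrl /=; apply: eq_bigr => u uP.
  by rewrite inE; case: on_line; case: on_line.
apply: (@leq_trans (\sum_(u in P) \sum_(v in P) ((u == v) * #|F| + 1))%N).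
  by apply: leq_sum => u uP; apply: leq_sum => v vP; apply: card_lines_through.
rewrite -mulnn -!sum_nat_const -big_split /=.
apply: leq_sum => u uP; rewrite big_split /= sum1_card leq_add2r.
rewrite (bigD1 u) //= eqxx mul1n big1 ?addn0 // => v /andP[_ vu].
by rewrite eq_sym (negPf vu).
Qed.

(** A variance bound: a line carries |P|/q points on average. Cauchy-Schwarz over [L], then
    extension of the sum of squared deviations to all lines, where the second moment bounds it;
    scaling by q keeps everything in [int]. *)
Lemma incidence_bound P L :
  (#|F|%:R * (\sum_(l in L) line_card P l)%:R - #|P|%:R * #|L|%:R) ^+ 2
    <= #|F|%:R ^+ 3 * #|P|%:R * #|L|%:R :> int.
Proof.
set q : int := #|F|%:R.
have -> : q * (\sum_(l in L) line_card P l)%:R - #|P|%:R * #|L|%:R =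
    \sum_(l in L) (q * (line_card P l)%:R - #|P|%:R).
  by rewrite sumrB -mulr_sumr natr_sum sumr_const mulr_natr.
apply: (le_trans (sum_sqr_le _ _)).
rewrite [leRHS]mulrC ler_wpM2l //.
apply: (@le_trans _ _ (\sum_l (q * (line_card P l)%:R - #|P|%:R) ^+ 2)).
  by rewrite [leRHS](bigID (mem L)) /= lerDl sumr_ge0 // => l _; apply: sqr_ge0.
have -> : \sum_l (q * (line_card P l)%:R - #|P|%:R) ^+ 2 =
    q ^+ 2 * (\sum_l line_card P l ^ 2)%N%:R - q ^+ 2 * #|P|%:R ^+ 2.
  rewrite (eq_bigr (fun l => q ^+ 2 * (line_card P l ^ 2)%N%:R +
      ((- (q * #|P|%:R *+ 2)) * (line_card P l)%:R + #|P|%:R ^+ 2))); last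
    by move=> l _; rewrite natrX; ring.
  rewrite !big_split /= -!mulr_sumr -!natr_sum.
  rewrite sum_line_card sumr_const card_prod.
  by rewrite -[_ *+ (_ * _)]mulr_natr !natrM -/q; ring.
have := sum_line_card_sqr P; rewrite -(ler_nat int) natrD natrM natrX -/q => h.
have := ler_wpM2l (sqr_ge0 q) h => h2.
rewrite lerBlDr; apply: (le_trans h2); rewrite le_eqVlt.
by apply/orP; left; apply/eqP; ring.
Qed.

End Incidences.

(** * Averaging for total relations *)

(** Every ordered pair is related in one of the two directions, and both directions have the same
    total count. *)
Lemma total_rel_card_sqr (T : finType) (e : rel T) (A : {set T}) :
    {in A &, total e} ->
  (#|A| ^ 2 <= 2 * \sum_(a in A) #|[set b in A | e a b]|)%N.
Proof.
move=> eT; have outE a : #|[set b in A | e a b]| = (\sum_(b in A) e a b)%N.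
  rewrite -sum1_card big_mkcond [RHS]big_mkcond; apply: eq_bigr => b _.
  by rewrite inE; case: (b \in A); case: (e a b).
under eq_bigr => a _ do rewrite outE.
rewrite mul2n -addnn {2}exchange_big -big_split /= -mulnn -!sum_nat_const.
apply: leq_sum => a aA; rewrite -sum1_card -big_split /=.
by apply: leq_sum => b bA; have := eT _ _ aA bA; case: (e a b); case: (e b a).
Qed.

Lemma total_rel_large_out (T : finType) (e : rel T) (A : {set T}) :
    {in A &, total e} -> A != finset.set0 ->
  exists2 a, a \in A & (#|A| <= 2 * #|[set b in A | e a b]|)%N.
Proof.
move=> eT A0; apply/exists_inP; apply: contraT => /exists_inPn small.
have := total_rel_card_sqr eT; rewrite leqNgt => /negP[].
rewrite big_distrr /= -mulnn -sum_nat_const.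
have /finset.set0Pn[a aA] := A0.
rewrite (bigD1 a aA) [ltnRHS](bigD1 a aA) /= -addSn leq_add //.
  by rewrite ltnNge small.
by apply: leq_sum => b /andP[bA _]; rewrite ltnW // ltnNge small.
Qed.

(** * The two bounds for admissible sets *)

(** As 12 x <= q, the expected term P m x <= 3 x^2 m^2 is at most q x m^2 / 4, half of the lower
    bound for q I. The deviation is thus at least q x m^2 / 4, and squaring gives 48 = 16 * 3. *)
Lemma incidence_arith (R : realDomainType) (q x m I P : R) :
    0 < x -> 0 < m -> 12 * x <= q -> 0 <= P -> P <= 3 * x * m ->
    x * m ^+ 2 <= 2 * I ->
    (q * I - P * (m * x)) ^+ 2 <= q ^+ 3 * P * (m * x) ->
  m ^+ 2 <= 48 * q.
Proof.
move=> x0 m0 xq P0 Pxm mI inc; have q0 : 0 < q by lra.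
have mx0 : 0 < m * x by rewrite mulr_gt0.
have xm0 : 0 < x * m ^+ 2 by rewrite mulr_gt0 ?exprn_gt0.
have D_ge : q * (x * m ^+ 2) <= 4 * (q * I - P * (m * x)).
  have h1 := ler_wpM2l (ltW q0) mI.
  have h2 := ler_wpM2r (ltW mx0) Pxm.
  have h3 := ler_wpM2r (ltW xm0) xq.
  have e1 : 12 * x * (x * m ^+ 2) = 4 * (3 * x * m * (m * x)) by ring.
  lra.
have qxm0 : 0 <= q * (x * m ^+ 2) by rewrite mulr_ge0 // ltW.
have D_sqr : (q * (x * m ^+ 2)) ^+ 2 <= 16 * (q ^+ 3 * (3 * x * m) * (m * x)).
  apply: (@le_trans _ _ ((4 * (q * I - P * (m * x))) ^+ 2)).
    by rewrite lerXn2r ?nnegrE // (le_trans qxm0).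
  rewrite exprMn -natrX ler_wpM2l // (le_trans inc) //.
  by rewrite ler_wpM2r ?(ltW mx0) // ler_wpM2l // exprn_ge0 // ltW.
have c0 : 0 < (q * x * m) ^+ 2 by rewrite exprn_gt0 // !mulr_gt0.
rewrite -(ler_pM2l c0) -subr_ge0.
by move: D_sqr; rewrite -subr_ge0; congr (0 <= _); ring.
Qed.

Section Prime.
Variables (p x : nat) (p_pr : prime p).
Implicit Types A : {set 'F_p}.

Lemma absFp_leP (r : 'F_p) :
  (absFp r <= x)%N -> exists2 n : int, (`|n| <= x)%N & n%:~R = r.
Proof.
rewrite /absFp /absmod; case: ex_minnP => n /asboolP[k ->] _ kx.
exists (r%:Z + k * p%:Z) => //.
rewrite intrD intrM -!pmulrn (pchar_Fp_0 p_pr) mulr0 addr0.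
apply: val_inj; rewrite /= val_Fp_nat // modn_small //.
by rewrite -[X in (_ < X)%N](Fp_cast p_pr).
Qed.

(** Totality expresses that one of the two ratios is small, in the form required by the averaging
    lemmas. *)
Definition ratio_close A :=
  {in A &, total (fun a b : 'F_p => absFp (b / a) <= x)%N}.

Lemma ratio_close_card_sqr A : (0 < x)%N -> (12 * x <= p)%N ->
  0 \notin A -> ratio_close A -> (#|A| ^ 2 <= 48 * p)%N.
Proof.
move=> x0 xp A0 Ax.
pose m := #|A|.
pose N := (\sum_(a in A) #|[set b in A | absFp (b / a)%R <= x]|)%N.
have mN : (m ^ 2 <= 2 * N)%N by exact: total_rel_card_sqr Ax.
pose J : {set 'F_p} := [set (j : nat)%:R | j : 'I_x].
have JE : #|J| = x.
  rewrite card_imset ?card_ord // => i j /(congr1 val) /=.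
  rewrite !val_Fp_nat // !modn_small; first exact: val_inj.
    by have := ltn_ord j; lia.
  by have := ltn_ord i; lia.
(* The differences j - r with 0 <= j < x and |r| <= x lie in [-x, 2x - 1], whence 3x values after a
   shift by x. *)
pose J' : {set 'F_p} := [set (i : nat)%:R - x%:R | i : 'I_(3 * x)].
have J'le : (#|J'| <= 3 * x)%N.
  by rewrite -[leqRHS]card_ord; apply: leq_imset_card.
pose P := finset.setX J' A.
pose f (u : 'F_p * 'F_p) : 'F_p * 'F_p := (- u.1, u.1 * u.2).
have fI : {in finset.setX A J &, injective f}.
  move=> [a j] [a' j']; rewrite !inE /= => /andP[aA _] _ faj.
  have [/oppr_inj aE ajE] := (congr1 fst faj, congr1 snd faj).
  rewrite /= in aE ajE; move: ajE; rewrite -aE => /mulfI -> //.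
  by apply: contraNneq A0 => <-.
pose L := f @: finset.setX A J.
have LE : #|L| = (m * x)%N by rewrite card_in_imset // cardsX JE.
have Ple : (#|P| <= 3 * x * m)%N by rewrite cardsX leq_mul2r J'le orbT.
set I := (\sum_(l in L) line_card P l)%N.
(* For each of the x values of j, a pair with b = r a gives the point (j - r, b) on the line y = a
   (j - t) in the variable t; distinct b give distinct points. *)
have NI : (x * N <= I)%N.
  rewrite /I big_imset //= big_distrr /=.
  rewrite (eq_bigl (fun u => (u.1 \in A) && (u.2 \in J))); last first.
    by move=> u; rewrite inE.
  rewrite -(pair_big (mem A) (mem J) (fun a j => line_card P (f (a, j)))) /=.
  apply: leq_sum => a aA; rewrite -{1}JE -sum_nat_const.
  apply: leq_sum => _ /imsetP[j _ ->].
  have a0 : a != 0 by apply: contraNneq A0 => <-.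
  rewrite /line_card -(card_imset (f := fun b => (j%:R - b / a, b))); last
    by move=> b b' [].
  apply: subset_leq_card; apply/fintype.subsetP => _ /imsetP[b + ->].
  rewrite !inE /on_line /= => /andP[bA /absFp_leP[r rx rE]].
  rewrite bA andbT; apply/andP; split; last first.
    by rewrite mulNr mulrBr [a * (b / a)]mulrC divfK // opprB subrK.
  have ij : (`|((j : nat)%:Z - r + x%:Z)%R| < 3 * x)%N.
    by have := ltn_ord j; lia.
  apply/imsetP; exists (Ordinal ij) => //=.
  rewrite [in RHS]pmulrn gez0_abs; last by have := ltn_ord j; lia.
  by rewrite intrD intrB rE addrK.
have := incidence_bound P L; rewrite -/I card_Fp // LE => inc.
have [m0|m0] := posnP m; first by rewrite -/m m0.
rewrite -/m -(ler_nat int) natrX natrM.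
apply: (@incidence_arith _ p%:R x%:R m%:R I%:R #|P|%:R).
- by rewrite ltr0n.
- by rewrite ltr0n.
- by rewrite -natrM ler_nat.
- by rewrite ler0n.
- by rewrite -!natrM ler_nat.
- by rewrite -natrX -!natrM ler_nat; nia.
- by rewrite natrM in inc.
Qed.

Lemma ratio_close_card_divisors A (T : nat) : (0 < x)%N -> (x < p)%N ->
    0 \notin A -> ratio_close A ->
    (forall n, 0 < n <= 3 * x ^ 2 -> size (divisors n) <= T)%N ->
  (#|A| <= 8 * (2 * ((x ^ 2 + x) %/ p) + 1) * T)%N.
Proof.
move=> x0 xp A0 Ax divT.
have [->|An0] := eqVneq A finset.set0; first by rewrite cards0.
have [s sA sle] := total_rel_large_out Ax An0.
set A' := [set b in A | _] in sle.
have s0 : s != 0 by apply: contraNneq A0 => <-.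
have A'n0 : A' != finset.set0.
  apply: contraTneq sle => ->; rewrite cards0 muln0 leqn0 cards_eq0; exact: An0.
have A'A : {subset A' <= A} by move=> b; rewrite inE => /andP[].
(* The relation is reversed so that the second choice makes a/b small, not b/a; then (a/b)(b/s) =
   a/s is a product of small ratios. *)
have A'x : {in A' &, total (fun a b : 'F_p => absFp (a / b) <= x)%N}.
  by move=> a b /A'A aA /A'A bA; rewrite orbC; apply: Ax.
have [a aA' ale] := total_rel_large_out A'x A'n0.
set B := [set b in A' | _] in ale.
have [alpha alphax alphaE] : exists2 n : int, (`|n| <= x)%N & n%:~R = a / s.
  by apply: absFp_leP; move: aA'; rewrite inE => /andP[].
have a0 : a != 0 by apply: contraNneq A0 => <-; apply: A'A.
set K := ((x ^ 2 + x) %/ p)%N.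
have Kp : (K * p <= x ^ 2 + x)%N by apply: leq_divM.
have K_max k : (k * p <= x ^ 2 + x -> k <= K)%N.
  by rewrite leq_divRL ?prime_gt0.
clearbody K.
(* The index i encodes k = i - K, so that i < 2K + 1 covers all |k| <= K. *)
pose n_ (i : nat) : nat := `|(alpha - (i%:Z - K%:Z) * p%:Z)%R|%N.
(* Candidates for b = s beta, where beta is a divisor of alpha - k p up to sign. *)
pose vals i := [seq s * ((-1) ^+ (sg : bool) * d%:R) : 'F_p |
  sg <- [:: false; true], d <- divisors (n_ i)].
have alphaF : alpha%:~R != 0 :> 'F_p.
  by rewrite alphaE mulf_neq0 ?invr_eq0.
have n_gt0 i : (0 < n_ i)%N.
  rewrite absz_gt0; apply: contraNneq alphaF => /eqP.
  rewrite subr_eq0 => /eqP ->.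
  by rewrite intrM -[p%:Z%:~R]pmulrn (pchar_Fp_0 p_pr) mulr0.
(* Here |alpha| + K p <= x + (x^2 + x) <= 3 x^2. *)
have n_le i : (i < 2 * K + 1)%N -> (n_ i <= 3 * x ^ 2)%N.
  move=> iK; have : (`|((i%:Z - K%:Z) * p%:Z)%R| <= K * p)%N.
    by rewrite abszM leq_mul //; clear - iK; lia.
  move: x0 alphax Kp; rewrite -mulnn /n_; set t := _ * p%:Z; clearbody t.
  by clear; nia.
pose vs := [seq v | i <- iota 0 (2 * K + 1), v <- vals i].
have vs_size : (size vs <= (2 * K + 1) * (2 * T))%N.
  rewrite size_allpairs_dep sumnE big_map -{2}[(2 * K + 1)%N](size_iota 0).
  rewrite -sum1_size big_distrl /= big_seq [leqRHS]big_seq.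
  apply: leq_sum => i; rewrite mem_iota => /andP[_ iK].
  by rewrite mul1n size_allpairs leq_mul2l divT // n_gt0 n_le.
have Bvs : {subset B <= vs}.
  move=> b; rewrite !inE => /andP[/andP[bA /absFp_leP[beta betax betaE]]].
  move=> /absFp_leP[r rx rE].
  have b0 : b != 0 by apply: contraNneq A0 => <-.
  have : (alpha - r * beta)%:~R == 0 :> 'F_p.
    rewrite intrB intrM alphaE betaE rE subr_eq0; apply/eqP.
    by rewrite mulrA divfK.
  rewrite -(dvdz_pcharf (pchar_Fp p_pr)) => /dvdzP[k kE].
  have kK : (`|k| <= K)%N.
    apply: K_max; rewrite -[X in (_ * X)%N]/(`|p%:Z|%N) -abszM -kE.
    have : (`|(r * beta)%R| <= x ^ 2)%N by rewrite abszM -mulnn leq_mul.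
    by clear - alphax; lia.
  have n_E : n_ `|(k + K%:Z)%R|%N = (`|r| * `|beta|)%N.
    rewrite /n_ gez0_abs; last by clear - kK; lia.
    by rewrite addrK -kE opprB addrC subrK abszM.
  apply/allpairsPdep; exists `|(k + K%:Z)%R|%N, b; split => //.
    by rewrite mem_iota; clear - kK; lia.
  apply/allpairsP; exists (beta < 0, `|beta|%N); split => /=.
  - by rewrite !inE; case: (beta < 0).
  - by rewrite -dvdn_divisors ?n_gt0 // n_E dvdn_mull.
  - have -> : (-1) ^+ (beta < 0)%R * `|beta|%N%:R = beta%:~R :> 'F_p.
      by rewrite [in RHS](intEsign beta) intrM rmorphXn /= -pmulrn.
    by rewrite betaE mulrC divfK.
have Ble : (#|B| <= (2 * K + 1) * (2 * T))%N.
  apply: leq_trans vs_size; rewrite cardE; apply: uniq_leq_size (enum_uniq _) _.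
  by move=> b; rewrite mem_enum; apply: Bvs.
(* The factor 8 comes from two halvings and the two signs. *)
by move: sle ale Ble; clear; nia.
Qed.

End Prime.

(** * Passage to real exponents and conclusion *)

Lemma size_divisors_powR (R : realType) (eps : R) : 0 < eps ->
  exists2 C : R, 1 <= C & forall (X : R) (n : nat), 1 <= X -> (0 < n)%N ->
    n%:R <= 3 * X ^+ 2 -> (size (divisors n))%:R <= C * X `^ eps.
Proof.
(* With k >= 2 / eps, the k-th power of the divisor count is at most M n <= 3 M X^2 <= (3 M
   X^eps)^k, using X >= 1. *)
move=> eps0; pose k := (Num.truncn (2 / eps)).+1.
have keps : 2 <= eps * k%:R.
  by rewrite mulrC -ler_pdivrMr // ltW // truncnS_gt.
pose M := ((k ^ k) ^ (2 ^ k))%N.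
have M0 : (0 < M)%N by rewrite !expn_gt0.
exists (3 * M)%:R; first by rewrite ler1n muln_gt0.
move=> X n X1 n0 nX; have X0 : 0 <= X by apply: le_trans X1.
rewrite -(@ler_pXn2r _ k) ?nnegrE ?mulr_ge0 ?powR_ge0 //.
apply: (@le_trans _ _ (M * n)%:R).
  by rewrite -natrX ler_nat; apply: size_divisors_expn.
rewrite exprMn -[X in _ * X]powR_mulrn ?powR_ge0 // -powRrM.
apply: (@le_trans _ _ ((3 * M)%:R * X `^ 2)).
  by rewrite powR_mulrn // !natrM [3 * M%:R]mulrC -mulrA ler_wpM2l.
apply: ler_pM; rewrite ?powR_ge0 //; last exact: ler_powR.
by rewrite -natrX ler_nat -[leqLHS]expn1 leq_pexp2l // muln_gt0.
Qed.

Unset Implicit Arguments.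

Theorem theorem1 (R : realType) (eps : R) (heps : 0 < eps) :
  exists C : R, 0 < C /\
    forall (p : nat) (X : R), prime p -> 1 <= X -> X <= p%:R / 12%:R ->
      (maxcard p X)%:R <=
        C * Num.min (X `^ eps + X `^ (2%:R + eps) / p%:R) (p%:R `^ (1 / 2%:R)).
Proof.
have [C0 C01 divC0] := size_divisors_powR heps.
(* 32 = 8 * 2 * 2 arises from 8 (2K + 1) with K <= 2 X^2 / p, and 7 from 48 <= 7^2. *)
exists (32 * C0 + 7); split; first by lra.
move=> p X p_pr X1 Xp; have X0 : 0 <= X by lra.
have p0 : 0 < p%:R :> R by rewrite ltr0n prime_gt0.
pose x := Num.truncn X.
have xX : x%:R <= X by rewrite truncn_le.
have x0 : (0 < x)%N by rewrite truncn_gt0.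
have xp : (12 * x <= p)%N.
  by rewrite -(ler_nat R) natrM mulrC -ler_pdivlMr //; apply: le_trans Xp.
set u := _ * _.
have u0 : 0 <= u.
  by rewrite mulr_ge0 ?le_min ?addr_ge0 ?divr_ge0 ?powR_ge0 //; lra.
(* The maximum is taken in [nat], so the real bound is truncated before passing to a single set. *)
rewrite -truncn_ge_nat //; apply/bigmax_leqP => A /andP[A0 Ax].
rewrite truncn_ge_nat //.
have {}A0 : 0 \notin A.
  by apply/negP => /(fintype.subsetP A0); rewrite !inE eqxx.
have {}Ax : ratio_close x A.
  move=> a b aA bA; rewrite !truncn_ge_nat //.
  by move/forall_inP: Ax => /(_ b bA) /forall_inP /(_ a aA).
rewrite /u minr_pMr; last by lra.
rewrite le_min; apply/andP; split.
- pose T := Num.truncn (C0 * X `^ eps).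
  have CX0 : 0 <= C0 * X `^ eps by rewrite mulr_ge0 ?powR_ge0 //; lra.
  have divT n : (0 < n <= 3 * x ^ 2)%N -> (size (divisors n) <= T)%N.
    move=> /andP[n0 nx]; rewrite truncn_ge_nat // divC0 //.
    apply: (@le_trans _ _ (3 * x ^ 2)%:R); first by rewrite ler_nat.
    by rewrite natrM natrX ler_wpM2l // lerXn2r ?nnegrE.
  have xltp : (x < p)%N by apply: leq_trans xp; rewrite ltn_Pmull.
  have := ratio_close_card_divisors p_pr x0 xltp A0 Ax divT.
  rewrite -(ler_nat R) => /le_trans; apply.
  rewrite !natrM natrD natrM.
  have TC : T%:R <= C0 * X `^ eps by rewrite truncn_le.
  set K := ((x ^ 2 + x) %/ p)%N.
  (* K p <= x^2 + x <= 2 x^2 because x >= 1. *)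
  have KX : K%:R <= 2 * X ^+ 2 / p%:R.
    rewrite ler_pdivlMr // -natrM.
    apply: (@le_trans _ _ (2 * x ^ 2)%:R).
      rewrite ler_nat (leq_trans (leq_divM _ _)) // mul2n -addnn leq_add2l.
      by rewrite -mulnn leq_pmulr.
    by rewrite natrM natrX ler_wpM2l // lerXn2r ?nnegrE.
  have -> : X `^ (2 + eps) = X ^+ 2 * X `^ eps.
    by rewrite powRD ?powR_mulrn //; apply/implyP => _; lra.
  have Xe0 : 0 <= X `^ eps by apply: powR_ge0.
  apply: (@le_trans _ _ (8 * (2 * (2 * X ^+ 2 / p%:R) + 1) * (C0 * X `^ eps))).
    by rewrite ler_pM ?mulr_ge0 ?addr_ge0 //; lra.
  have Y0 : 0 <= X ^+ 2 / p%:R by rewrite divr_ge0 ?exprn_ge0 // ltW.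
  rewrite -[2 * X ^+ 2 / _]mulrA [X ^+ 2 * X `^ eps / _]mulrAC.
  set Y := X ^+ 2 / p%:R in Y0 *; set Z := X `^ eps in Xe0 *.
  have := mulr_ge0 Y0 Xe0; nra.
- rewrite div1r powR12_sqrt; last exact: ltW.
  have := ratio_close_card_sqr p_pr x0 xp A0 Ax.
  rewrite -(ler_nat R) natrX natrM => h.
  apply: (@le_trans _ _ (7 * Num.sqrt p%:R)).
    rewrite -(@ler_pXn2r _ 2) ?nnegrE ?mulr_ge0 ?sqrtr_ge0 //.
    by rewrite exprMn sqr_sqrtr ?(ltW p0) //; lra.
  by rewrite ler_wpM2r ?sqrtr_ge0 //; lra.
Qed.
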